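(* Let $(S_1,S_2,P)$ be a triple of commuting bounded operators acting on a Hilbert space $\mathcal H$. Then the following are equivalent: (1) $(S_1,S_2,P)$ is a $\Gamma_3$-contraction; (2) for all holomorphic polynomials $f$ in three variables, $$\|f(S_1,S_2,P)\|\le\|f\|_{\infty,\Gamma_3}=\sup\{|f(s_1,s_2,p)|:(s_1,s_2,p)\in\Gamma_3\};$$ (3) $(\omega S_1,\omega^2 S_2,\omega^3 P)$ is a $\Gamma_3$-contraction for every $\omega\in\mathbb T$.
   Context: All operators are bounded linear operators on complex Hilbert spaces, and $\mathbb T$ is the unit circle in $\mathbb C$. The closed symmetrized tridisc is $$\Gamma_3=\{(z_1+z_2+z_3,\ z_1z_2+z_2z_3+z_3z_1,\ z_1z_2z_3): z_i\in\mathbb C,\ |z_i|\le 1,\ i=1,2,3\}\subseteq\mathbb C^3.$$ A compact set $X\subseteq\mathbb C^n$ is a spectral set for a commuting $n$-tuple $\underline T=(T_1,\dots,T_n)$ of bounded operators on a Hilbert space if the Taylor joint spectrum $\sigma_T(\underline T)$ is contained in $X$ and $\|f(\underline T)\|\le \|f\|_{\infty,X}=\sup\{|f(z)|: z\in X\}$ for all $f\in\mathcal R(X)$, where $\mathcal R(X)$ is the algebra of quotients $p/q$ of holomorphic polynomials in $n$ variables such that $q$ has no zeros in $X$. A triple of commuting operators $(S_1,S_2,P)$ on a Hilbert space is a $\Gamma_3$-contraction if $\Gamma_3$ is a spectral set for it. *)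

(* Defs.v *)
From HB Require Import structures.
From mathcomp Require Import all_boot all_order all_algebra.
From mathcomp Require Import complex.
From mathcomp Require Import all_classical all_reals all_analysis.
(* The notations of mpoly clash with those of MathComp-Analysis. *)
From mathcomp Require Import -(notations) mpoly.

Set Implicit Arguments.
Unset Strict Implicit.
Unset Printing Implicit Defensive.

Import Order.TTheory GRing.Theory Num.Theory.
Import numFieldNormedType.Exports.
Local Open Scope classical_set_scope.
Local Open Scope ring_scope.
Local Open Scope complex_scope.

(* The inner product is linear in the first variable and conjugate-linear in
   the second one. *)
HB.mixin Record NormedModule_isHilbert (R : realType) H
    of CompleteNormedModule R[i] H := {
  hdot : {dot H for Num.conj} ;
  hdot_norm : forall x : H, hdot x x = `|x| ^+ 2
}.

#[short(type="hilbertType")]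
HB.structure Definition Hilbert (R : realType) :=
  {H of CompleteNormedModule R[i] H & NormedModule_isHilbert R H}.

(* The library norm of a vector space over R[i] takes its values in R[i]; it is
   a nonnegative real number, so taking the real part only changes its type. *)
Definition rnorm (R : realType) (V : normedZmodType R[i]) (x : V) : R :=
  complex.Re `|x|.

Lemma rnormE (R : realType) (V : normedZmodType R[i]) (x : V) :
  (rnorm x)%:C = `|x|.
Proof. by rewrite /rnorm RRe_real// ger0_real. Qed.

Section BoundedOperators.
Context {R : realType}.

Definition bounded_op (H : hilbertType R) (T : H -> H) :=
  exists M : R, forall x, rnorm (T x) <= M * rnorm x.

Record boundedOp (H : hilbertType R) := BoundedOp {
  bop_fun :> H -> H ;
  bop_linear : linear bop_fun ;
  bop_bounded : bounded_op bop_fun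
}.

Context {H : hilbertType R}.
Implicit Types (S T U : boundedOp H) (a b : R[i]) (x y : H).

HB.instance Definition _ T := GRing.isLinear.Build R[i] H H _ T (@bop_linear H T).

HB.instance Definition _ := gen_eqMixin (boundedOp H).
HB.instance Definition _ := gen_choiceMixin (boundedOp H).

Lemma bopP S T : S =1 T -> S = T.
Proof.
case: S T => [s ls bs] [t lt bt] /= /funext st.
by subst t; congr BoundedOp; exact: Prop_irrelevance.
Qed.

Lemma rnorm_ge0 (V : normedZmodType R[i]) (x : V) : 0 <= rnorm x.
Proof. by rewrite -ler0c rnormE. Qed.

Lemma ler_rnormD (V : normedZmodType R[i]) (x y : V) :
  rnorm (x + y) <= rnorm x + rnorm y.
Proof. by rewrite -lecR rmorphD/= !rnormE ler_normD. Qed.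

Lemma rnormZ a x : rnorm (a *: x) = rnorm (a : R[i]^o) * rnorm x.
Proof. by apply: (@complexI R); rewrite rmorphM/= !rnormE normrZ. Qed.

Lemma rnormN (V : normedZmodType R[i]) (x : V) : rnorm (- x) = rnorm x.
Proof. by rewrite /rnorm normrN. Qed.

Lemma bop0_linear : linear (fun _ : H => 0 : H).
Proof. by move=> a x y; rewrite scaler0 addr0. Qed.
Lemma bop0_bounded : bounded_op (fun _ : H => 0 : H).
Proof. by exists 0 => x; rewrite mul0r /rnorm normr0. Qed.
Definition bop0 := BoundedOp bop0_linear bop0_bounded.

Lemma bop1_linear : linear (@idfun H).
Proof. by []. Qed.
Lemma bop1_bounded : bounded_op (@idfun H).
Proof. by exists 1 => x; rewrite mul1r. Qed.
Definition bop1 := BoundedOp bop1_linear bop1_bounded.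

Lemma bopD_linear S T : linear (fun x => S x + T x).
Proof. by move=> a x y; rewrite !linearP addrACA -scalerDr. Qed.
Lemma bopD_bounded S T : bounded_op (fun x => S x + T x).
Proof.
have [M SM] := bop_bounded S; have [N TN] := bop_bounded T.
by exists (M + N) => x; rewrite mulrDl (le_trans (ler_rnormD _ _))// lerD.
Qed.
Definition bopD S T := BoundedOp (bopD_linear S T) (bopD_bounded S T).

Lemma bopN_linear T : linear (fun x => - T x).
Proof. by move=> a x y; rewrite linearP opprD scalerN. Qed.
Lemma bopN_bounded T : bounded_op (fun x => - T x).
Proof. by have [M TM] := bop_bounded T; exists M => x; rewrite rnormN. Qed.
Definition bopN T := BoundedOp (bopN_linear T) (bopN_bounded T).

Lemma bopZ_linear a T : linear (fun x => a *: T x).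
Proof. by move=> b x y; rewrite linearP scalerDr !scalerA mulrC. Qed.
Lemma bopZ_bounded a T : bounded_op (fun x => a *: T x).
Proof.
have [M TM] := bop_bounded T; exists (rnorm (a : R[i]^o) * M) => x.
by rewrite rnormZ -mulrA ler_wpM2l ?rnorm_ge0.
Qed.
Definition bopZ a T := BoundedOp (bopZ_linear a T) (bopZ_bounded a T).

Lemma bopM_linear S T : linear (S \o T).
Proof. by move=> a x y; rewrite /= !linearP. Qed.
Lemma bopM_bounded S T : bounded_op (S \o T).
Proof.
have [M SM] := bop_bounded S; have [N TN] := bop_bounded T.
exists (`|M| * N) => x /=; rewrite (le_trans (SM _))// -mulrA.
by rewrite (le_trans (ler_wpM2r (rnorm_ge0 _) (ler_norm M)))// ler_wpM2l.
Qed.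
Definition bopM S T := BoundedOp (bopM_linear S T) (bopM_bounded S T).

Lemma bopDA : associative bopD.
Proof. by move=> S T U; apply: bopP => x /=; rewrite addrA. Qed.
Lemma bopDC : commutative bopD.
Proof. by move=> S T; apply: bopP => x /=; rewrite addrC. Qed.
Lemma bop0D : left_id bop0 bopD.
Proof. by move=> T; apply: bopP => x /=; rewrite add0r. Qed.
Lemma bopND : left_inverse bop0 bopN bopD.
Proof. by move=> T; apply: bopP => x /=; rewrite addNr. Qed.
HB.instance Definition _ :=
  GRing.isZmodule.Build (boundedOp H) bopDA bopDC bop0D bopND.

Lemma bopMA : associative bopM.
Proof. by move=> S T U; apply: bopP. Qed.
Lemma bop1M : left_id bop1 bopM.
Proof. by move=> T; apply: bopP. Qed.
Lemma bopM1 : right_id bop1 bopM.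
Proof. by move=> T; apply: bopP. Qed.
Lemma bopMDl : left_distributive bopM bopD.
Proof. by move=> S T U; apply: bopP. Qed.
Lemma bopMDr : right_distributive bopM bopD.
Proof. by move=> S T U; apply: bopP => x /=; rewrite linearD. Qed.
HB.instance Definition _ :=
  GRing.Zmodule_isPzRing.Build (boundedOp H) bopMA bop1M bopM1 bopMDl bopMDr.

Lemma bopZA a b T : bopZ a (bopZ b T) = bopZ (a * b) T.
Proof. by apply: bopP => x /=; rewrite scalerA. Qed.
Lemma bop1Z : left_id 1 bopZ.
Proof. by move=> T; apply: bopP => x /=; rewrite scale1r. Qed.
Lemma bopZDr : right_distributive bopZ +%R.
Proof. by move=> a S T; apply: bopP => x /=; rewrite scalerDr. Qed.
Lemma bopZDl T : {morph bopZ^~ T : a b / a + b}.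
Proof. by move=> a b; apply: bopP => x /=; rewrite scalerDl. Qed.
HB.instance Definition _ :=
  GRing.Zmodule_isLmodule.Build R[i] (boundedOp H) bopZA bop1Z bopZDr bopZDl.

Definition opnorm T : R := sup [set rnorm (T x) | x in [set x | rnorm x <= 1]].

End BoundedOperators.

Section JointSpectrum.
Context {R : realType} {H : hilbertType R} {n : nat}.
Implicit Types (T : 'I_n -> boundedOp H) (X : set 'rV[R[i]^o]_n).
Implicit Types (p q : mpoly n R[i]).

Definition commuting T := forall i j, GRing.comm (T i) (T j).

(* Koszul differential of T on H (x) Lambda(C^n): x I is the coefficient of x
   on e_I = e_i1 /\ .. /\ e_ik for I = {i1 < .. < ik}, the differential maps
   v (x) e_J to \sum_i (T_i v) (x) (e_i /\ e_J), and, for i \notin J,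
   e_i /\ e_J is (-1) ^ #{j in J | j < i} times e_(i |: J). *)
Definition koszul T (x : {ffun {set 'I_n} -> H}) : {ffun {set 'I_n} -> H} :=
  [ffun I : {set 'I_n} =>
    \sum_(i in I) (-1) ^+ #|[set j in I | (j < i)%N]| *: T i (x (I :\ i))].

(* Exactness of the whole complex, in all degrees at once. *)
Definition koszul_exact T := [set x | koszul T x = 0] = range (koszul T).

Definition taylor_spectrum T : set 'rV[R[i]^o]_n :=
  [set z : 'rV[R[i]^o]_n |
    ~ koszul_exact (fun i => T i - (z 0 i : R[i]) *: (1 : boundedOp H))].

Definition mpoly_op p T : boundedOp H :=
  \sum_(m <- msupp p) (mcoeff m p : R[i]) *: \prod_(i < n) T i ^+ m i.

Definition mpoly_at p (z : 'rV[R[i]^o]_n) : R[i] := meval (z 0) p.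

Definition supnorm X (f : 'rV[R[i]^o]_n -> R[i]) : R :=
  sup [set rnorm (f z : R[i]^o) | z in X].

(* For f = p / q, the operator f(T) is p(T) q(T)^-1: the joint spectrum of T
   lies in X, where q does not vanish, hence q(T) is invertible. *)
Definition spectral_set X T :=
  [/\ compact X, commuting T, taylor_spectrum T `<=` X &
    forall p q, (forall z, X z -> mpoly_at q z != 0) ->
      exists Q : boundedOp H,
        [/\ mpoly_op q T * Q = 1, Q * mpoly_op q T = 1 &
          opnorm (mpoly_op p T * Q)
            <= supnorm X (fun z => mpoly_at p z / mpoly_at q z)]].

End JointSpectrum.

Definition triple (A : Type) (a b c : A) : 'I_3 -> A := tnth [tuple a; b; c].

Definition Gamma3 (R : realType) : set 'rV[R[i]^o]_3 :=
  [set s | exists z1 z2 z3 : R[i], [/\ `|z1| <= 1, `|z2| <= 1, `|z3| <= 1 &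
    s = \row_k triple (z1 + z2 + z3) (z1 * z2 + z2 * z3 + z3 * z1)
                      (z1 * z2 * z3) k]].
Arguments Gamma3 : clear implicits.

Definition Gamma3_contraction (R : realType) (H : hilbertType R)
    (S1 S2 P : boundedOp H) :=
  spectral_set (Gamma3 R) (triple S1 S2 P).

(* Main.v *)
Require Import Defs.
From mathcomp Require Import all_boot all_order all_algebra.
From mathcomp Require Import complex ring lra.
From mathcomp Require Import all_classical all_reals all_analysis.
From mathcomp Require Import -(notations) mpoly.
From mathcomp Require ssrcomplements.

Set Implicit Arguments.
Unset Strict Implicit.
Unset Printing Implicit Defensive.

Import Order.TTheory GRing.Theory Num.Theory.
Import numFieldNormedType.Exports.
Local Open Scope classical_set_scope.
Local Open Scope ring_scope.
Local Open Scope complex_scope.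

(** Write [X] for the closed symmetrized tridisc and [T] for the triple
    [(S1, S2, P)].  A spectral set satisfies the inequality for polynomials: take
    the denominator 1.  The condition on the rotated triples gives back the one on
    [T] for [w = 1].  The work is in passing from the inequality for polynomials to
    the full definition of a spectral set ([von_neumann_Gamma3_spectral]).  This
    then applies to the rotated triples too: [X] is stable under the dilations
    [(s1, s2, p) |-> (w s1, w^2 s2, w^3 p)] with [|w| <= 1], so the rotated triples
    inherit the inequality for polynomials from [T].

    The norm inequality for rational functions. Let [q] be a polynomial without
    zeros in [X]. If [1 / q] is a uniform limit on [X] of polynomials [r_k],
    then the inequality for polynomials makes [r_k(T)] a Cauchy sequence of
    operators; its limit inverts [q(T)], and the bound for [p(T) q(T)^-1] is the
    limit of the bounds for [(p r_k)(T)] ([rational_von_neumann]). Such [r_k]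
    exist as soon as there is one polynomial [r] with [|1 - r q| <= 1/2] on [X],
    since [1 - (1 - r q)^k] is again a multiple of [q]
    ([poly_invertible_approx]); and this property of [q] is stable under
    perturbations that are small compared with [min |q|]
    ([poly_invertible_perturb]). The dilations [q(t s1, t^2 s2, t^3 p)],
    [0 <= t <= 1], are all bounded below by [min |q|], because the dilations map
    [X] into itself, and they join [q] to the nonzero constant [q(0)]; finitely
    many small steps along this path do the job ([Gamma3_poly_invertible]).

    The Taylor spectrum.  Let [z] lie outside [X].  The cubic with elementary
    symmetric functions [z] has a root [a] of modulus greater than 1, and the
    polynomial [q(s1, s2, p) = a^3 - a^2 s1 + a s2 - p], which is of degree 1,
    vanishes at [z] but not on [X].  By the previous part [q(T)] is invertible; it
    is also a linear combination of the operators [T_i - z_i]; hence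
    [sum_i (T_i - z_i) G_i = 1] for some operators [G_i] that commute with [T],
    and contraction with [G] is a homotopy that makes the Koszul complex of
    [T - z] exact ([koszul_exact_of_unimodular]). *)

Local Notation cabs a := (rnorm (a : _^o)).

(** * Moduli and operator norms *)

Section Modulus.
Context {R : realType}.
Implicit Types a b : R[i].

Lemma cabsM a b : cabs (a * b) = cabs a * cabs b.
Proof. by apply: (@complexI R); rewrite rmorphM/= !rnormE normrM. Qed.

Lemma cabs1 : cabs (1 : R[i]) = 1.
Proof. by apply: (@complexI R); rewrite rnormE normr1. Qed.

Lemma cabsX a n : cabs (a ^+ n) = cabs a ^+ n.
Proof.
by elim: n => [|n IH]; [rewrite !expr0 cabs1|rewrite !exprS cabsM IH].
Qed.

Lemma cabsV a : cabs a^-1 = (cabs a)^-1.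
Proof. by apply: (@complexI R); rewrite rnormE normfV fmorphV/= rnormE. Qed.

Lemma cabs_real (x : R) : cabs x%:C = `|x|.
Proof.
suff cabs_nneg (y : R) : 0 <= y -> cabs y%:C = y.
  case: (ger0P x) => x0; first exact: cabs_nneg.
  by rewrite -(cabs_nneg (- x)) ?oppr_ge0 ?ltW// rmorphN [in RHS]rnormN.
by move=> y0; apply: (@complexI R); rewrite rnormE ger0_norm// ler0c.
Qed.

Lemma rnorm_eq0 (V : normedZmodType R[i]) (x : V) : (rnorm x == 0) = (x == 0).
Proof. by rewrite -(inj_eq (@complexI R)) rnormE normr_eq0. Qed.

Lemma rnorm0 (V : normedZmodType R[i]) : rnorm (0 : V) = 0.
Proof. by apply/eqP; rewrite rnorm_eq0. Qed.

Lemma rnorm_gt0 (V : normedZmodType R[i]) (x : V) : (0 < rnorm x) = (x != 0).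
Proof. by rewrite lt0r rnorm_ge0 andbT rnorm_eq0. Qed.

Lemma rnormB (V : normedZmodType R[i]) (x y : V) : rnorm (x - y) = rnorm (y - x).
Proof. by rewrite -rnormN opprB. Qed.

Lemma ler_rnormB (V : normedZmodType R[i]) (x y : V) :
  rnorm (x - y) <= rnorm x + rnorm y.
Proof. by rewrite (le_trans (ler_rnormD _ _))// rnormN. Qed.

Lemma cabs_le1 a : (`|a| <= 1) = (cabs a <= 1).
Proof. by rewrite -[in LHS](rnormE (a : R[i]^o)) -lecR. Qed.

End Modulus.

Section OperatorNorm.
Context {R : realType} {H : hilbertType R}.
Implicit Types (S T : boundedOp H) (x : H).

Let values T : set R := [set rnorm (T x) | x in [set x | rnorm x <= 1]].

Let has_sup_values T : has_sup (values T).
Proof.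
split; first by exists (rnorm (T 0)), 0 => //=; rewrite rnorm0 ler01.
have [M TM] := bop_bounded T; exists `|M| => _ [x /= x1 <-].
rewrite (le_trans (TM x))// (le_trans (ler_wpM2r (rnorm_ge0 _) (ler_norm M)))//.
by rewrite ler_piMr.
Qed.

Lemma opnorm_ge0 T : 0 <= opnorm T.
Proof.
apply: le_trans (ub_le_sup (has_sup_values T).2 _); first exact: (rnorm_ge0 (T 0)).
by exists 0 => //=; rewrite rnorm0 ler01.
Qed.

Lemma rnorm_le_opnorm T x : rnorm (T x) <= opnorm T * rnorm x.
Proof.
have [->|x0] := eqVneq x 0; first by rewrite linear0 !rnorm0 mulr0.
have nx0 : 0 < rnorm x by rewrite rnorm_gt0.
pose c : R[i] := ((rnorm x)^-1)%:C.
have cE : cabs c = (rnorm x)^-1 by rewrite cabs_real ger0_norm// invr_ge0 rnorm_ge0.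
suff : rnorm (T (c *: x)) <= opnorm T.
  by rewrite linearZ/= rnormZ cE ler_pdivrMl// mulrC.
apply: ub_le_sup (has_sup_values T).2 _ _; exists (c *: x) => //=.
by rewrite rnormZ cE mulVf// gt_eqF.
Qed.

Lemma opnorm_le T (M : R) :
  0 <= M -> (forall x, rnorm (T x) <= M * rnorm x) -> opnorm T <= M.
Proof.
move=> M0 TM; apply: ge_sup; first exact: (has_sup_values T).1.
by move=> _ [x /= x1 <-]; rewrite (le_trans (TM x))// ler_piMr.
Qed.

End OperatorNorm.

(** * Polynomials in commuting operators *)

Section FunctionalCalculus.
Context {R : realType} {H : hilbertType R}.
Implicit Types (S U : boundedOp H) (a b : R[i]) (x : H).

Lemma bopD_apply S U x : (S + U) x = S x + U x. Proof. by []. Qed.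
Lemma bopB_apply S U x : (S - U) x = S x - U x. Proof. by []. Qed.
Lemma bopM_apply S U x : (S * U) x = S (U x). Proof. by []. Qed.
Lemma bopZ_apply a S x : (a *: S) x = a *: S x. Proof. by []. Qed.

Lemma bop_sum_apply (I : Type) (r : seq I) (P : pred I) (F : I -> boundedOp H) x :
  (\sum_(i <- r | P i) F i) x = \sum_(i <- r | P i) F i x.
Proof.
by elim/big_rec2: _ => // i _ S _ <-.
Qed.

Lemma bopZAl a S U : (a *: S) * U = a *: (S * U).
Proof. exact: bopP. Qed.

Lemma bopZAr a S U : S * (a *: U) = a *: (S * U).
Proof. by apply: bopP => x; rewrite bopM_apply !bopZ_apply linearZ. Qed.

Lemma bop_commZ a S U : GRing.comm S U -> GRing.comm S (a *: U).
Proof. by rewrite /GRing.comm bopZAl bopZAr => ->. Qed.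

Context {n : nat}.
Variable T : 'I_n -> boundedOp H.
Implicit Types p q : mpoly n R[i].

Definition monomial_op (m : multinom n) : boundedOp H := \prod_(i < n) T i ^+ m i.

(** Summing over all monomials of bounded degree gives polynomials with different
    supports a common index set. *)
Lemma mpoly_opE k p : (msize p <= k)%N ->
  mpoly_op p T = \sum_(m : bmultinom n k) mcoeff m p *: monomial_op m.
Proof.
move=> pk; rewrite /mpoly_op (ssrcomplements.big_mksub (bmultinom n k)) ?msupp_uniq//=; last first.
  by move=> m /msize_mdeg_lt /leq_trans; apply.
by rewrite big_rmcond//= => m /memN_msupp_eq0 ->; rewrite scale0r.
Qed.

Lemma mpoly_opD p q : mpoly_op (p + q) T = mpoly_op p T + mpoly_op q T.
Proof.
pose k := maxn (msize (p + q)) (maxn (msize p) (msize q)).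
rewrite !(@mpoly_opE k) ?leq_max ?leqnn ?orbT// -big_split/=.
by apply: eq_bigr => m _; rewrite mcoeffD scalerDl.
Qed.

Lemma mpoly_opZ a p : mpoly_op (a *: p) T = a *: mpoly_op p T.
Proof.
pose k := maxn (msize (a *: p)) (msize p).
rewrite !(@mpoly_opE k) ?leq_max ?leqnn ?orbT// scaler_sumr.
by apply: eq_bigr => m _; rewrite mcoeffZ scalerA.
Qed.

Lemma mpoly_op0 : mpoly_op 0 T = 0.
Proof. by rewrite /mpoly_op msupp0 big_nil. Qed.

Lemma mpoly_opB p q : mpoly_op (p - q) T = mpoly_op p T - mpoly_op q T.
Proof. by rewrite mpoly_opD -scaleN1r mpoly_opZ scaleN1r. Qed.

Lemma mpoly_op_sum (I : Type) (r : seq I) (P : pred I) (F : I -> mpoly n R[i]) :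
  mpoly_op (\sum_(i <- r | P i) F i) T = \sum_(i <- r | P i) mpoly_op (F i) T.
Proof. exact: (big_morph (fun p => mpoly_op p T) mpoly_opD mpoly_op0). Qed.

Lemma mpoly_opX m : mpoly_op (mpolyX R[i] m) T = monomial_op m.
Proof. by rewrite /mpoly_op msuppX big_seq1 mcoeffX eqxx scale1r. Qed.

Lemma mpoly_op1 : mpoly_op 1 T = 1.
Proof.
rewrite -mpolyX0 mpoly_opX /monomial_op big1// => i _.
by rewrite mnm0E expr0.
Qed.

Lemma mpoly_opXU i : mpoly_op (mpolyX R[i] (mnm1 i)) T = T i.
Proof.
rewrite mpoly_opX /monomial_op (@big_only1 _ _ _ _ i)//= => [|j ji _].
  by rewrite mnm1E eqxx expr1.
by rewrite mnm1E eq_sym (negbTE ji) expr0.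
Qed.

Hypothesis T_comm : commuting T.

Lemma monomial_opD m1 m2 :
  monomial_op (mnm_add m1 m2) = monomial_op m1 * monomial_op m2.
Proof.
rewrite /monomial_op -prodrM_comm; last first.
  by move=> i j _ _; apply/commrX/commr_sym/commrX/T_comm.
by apply: eq_bigr => i _; rewrite mnmDE exprD.
Qed.

(** Both sides are bilinear, which reduces the claim to monomials, and there
    commutation lets the powers of each [T i] be collected. *)
Lemma mpoly_opM p q : mpoly_op (p * q) T = mpoly_op p T * mpoly_op q T.
Proof.
rewrite [p in LHS]mpolyE mulr_suml mpoly_op_sum [in RHS]/mpoly_op mulr_suml.
apply: eq_bigr => m _; rewrite -scalerAl [LHS]mpoly_opZ bopZAl; congr (_ *: _).
rewrite [q in LHS]mpolyE mulr_sumr mpoly_op_sum /mpoly_op mulr_sumr.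
apply: eq_bigr => k _; rewrite -scalerAr [LHS]mpoly_opZ bopZAr; congr (_ *: _).
by rewrite -mpolyXD mpoly_opX monomial_opD.
Qed.

Lemma mpoly_opXn p k : mpoly_op (p ^+ k) T = mpoly_op p T ^+ k.
Proof.
elim: k => [|k IH]; first by rewrite !expr0 mpoly_op1.
by rewrite !exprS mpoly_opM IH.
Qed.

Lemma mpoly_op_comm p q : GRing.comm (mpoly_op p T) (mpoly_op q T).
Proof. by rewrite /GRing.comm -!mpoly_opM mulrC. Qed.

Lemma mpoly_op_comp k (f : mpoly k R[i]) (g : k.-tuple (mpoly n R[i])) :
  mpoly_op (comp_mpoly g f) T = mpoly_op f (fun i => mpoly_op (tnth g i) T).
Proof.
rewrite comp_mpolyEX mpoly_op_sum; apply: eq_bigr => m _.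
rewrite mpoly_opZ; congr (_ *: _).
rewrite comp_mpolyX [LHS](big_morph (fun p => mpoly_op p T) mpoly_opM mpoly_op1).
by apply: eq_bigr => i _; rewrite mpoly_opXn.
Qed.

End FunctionalCalculus.

(** * Exactness of the Koszul complex *)

Section Koszul.
Context {R : realType} {H : hilbertType R} {n : nat}.
Implicit Types (I : {set 'I_n}) (i k : 'I_n) (x : {ffun {set 'I_n} -> H}).

(** The sign needed to move [e_i] to its place in [e_I]. *)
Definition wedge_sign I i : R[i] := (-1) ^+ #|[set j in I | (j < i)%N]|.

Lemma wedge_sign_add I i k :
  k \notin I -> wedge_sign (k |: I) i = (-1) ^+ (k < i)%N * wedge_sign I i.
Proof.
move=> kI; rewrite /wedge_sign -exprD; congr (_ ^+ _).
rewrite (cardsD1 k) !inE eqxx/=; congr (_ + _)%N; apply: eq_card => j.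
by rewrite !inE; case: eqVneq => // ->; rewrite (negbTE kI).
Qed.

Lemma wedge_sign_rem I i k :
  i \in I -> wedge_sign (I :\ i) k = (-1) ^+ (i < k)%N * wedge_sign I k.
Proof.
move=> iI; rewrite -[in RHS](finset.setD1K iI) wedge_sign_add ?finset.setD11//.
by rewrite signrMK.
Qed.

Lemma wedge_sign_sqr I i : wedge_sign I i * wedge_sign I i = 1.
Proof. by rewrite /wedge_sign -expr2 sqrr_sign. Qed.

Lemma sign_ltn_anti i k :
  i != k -> (-1) ^+ (i < k)%N = - (-1) ^+ (k < i)%N :> R[i].
Proof.
by move=> ik; case: ltngtP => [||/val_inj/eqP]; rewrite ?opprK// (negbTE ik).
Qed.

Variable T : 'I_n -> boundedOp H.
Hypothesis T_comm : commuting T.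

Lemma koszulE x I :
  koszul T x I = \sum_(i in I) wedge_sign I i *: T i (x (I :\ i)).
Proof. by rewrite ffunE. Qed.

(** Exchanging two indices flips the sign: the double sum is its own opposite. *)
Lemma koszul_koszul x : koszul T (koszul T x) = 0.
Proof.
apply/ffunP => I; rewrite [RHS]ffunE koszulE.
(* The term in which [i] is removed first and [k] second. *)
pose a i k := (-1) ^+ (i < k)%N * (wedge_sign I i * wedge_sign I k) *:
  T i (T k (x (I :\: [set i; k]))).
have aN i k : i != k -> a k i = - a i k.
  move=> ik; rewrite /a sign_ltn_anti 1?eq_sym// mulNr scaleNr; congr (- (_ *: _)).
    by rewrite [X in _ * X]mulrC.
  by rewrite finset.setUC -!bopM_apply T_comm.
have -> : \sum_(i in I) wedge_sign I i *: T i (koszul T x (I :\ i)) =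
    \sum_(i in I) \sum_(k in I | k != i) a i k.
  apply: eq_bigr => i iI; rewrite koszulE linear_sum scaler_sumr/=.
  apply: eq_big => [k|k _]; first by rewrite !inE andbC.
  rewrite linearZ/= scalerA wedge_sign_rem// finset.setDDl /a.
  by rewrite mulrCA.
set s := LHS; suff /eqP : s *+ 2 = 0.
  rewrite -scaler_nat scaler_eq0 pnatr_eq0/= => /eqP//.
rewrite mulr2n {2}/s (exchange_big_dep (mem I))/=; last by move=> i k _ /andP[].
rewrite /s -big_split big1//= => i iI.
rewrite [X in _ + X](eq_big (fun k => (k \in I) && (k != i)) (fun k => - a i k)).
- by rewrite sumrN subrr.
- by move=> k; rewrite iI/= eq_sym.
- by move=> k /and3P[_ _ ik]; rewrite aN.
Qed.

(** A solution of [\sum_i T_i G_i = 1] makes the contraction [h] by [G] a homotopy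
    between the identity of the Koszul complex and zero: in [d h + h d] the mixed
    terms [T_i G_k], [i <> k], cancel in pairs, and the terms [T_i G_i] add up to
    the identity.  So a cycle [x] is the boundary of [h x]. *)
Lemma koszul_exact_of_unimodular (G : 'I_n -> boundedOp H) :
    (forall i k, GRing.comm (T i) (G k)) -> \sum_i T i * G i = 1 ->
  koszul_exact T.
Proof.
move=> TG TG1; apply/seteqP; split; last first.
  by move=> _ [x _ <-]; exact: koszul_koszul.
pose h x : {ffun {set 'I_n} -> H} := [ffun I : {set 'I_n} =>
  \sum_(k in ~: I) wedge_sign I k *: G k (x (k |: I))].
suff homotopy x : koszul T (h x) + h (koszul T x) = x.
  move=> x /= Tx0; exists (h x) => //; rewrite -[RHS]homotopy Tx0.
  suff -> : h 0 = 0 by rewrite addr0.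
  apply/ffunP => I; rewrite !ffunE big1// => k _.
  by rewrite ffunE linear0 scaler0.
apply/ffunP => I; rewrite ffunE koszulE [h _ _]ffunE.
(* The mixed terms, which have opposite signs in [d h] and in [h d]. *)
pose c i k := (-1) ^+ (i < k)%N * (wedge_sign I i * wedge_sign I k) *:
  T i (G k (x (k |: (I :\ i)))).
have -> : \sum_(i in I) wedge_sign I i *: T i (h x (I :\ i)) =
    \sum_(i in I) T i (G i (x I)) + \sum_(i in I) \sum_(k in ~: I) c i k.
  rewrite -big_split/=; apply: eq_bigr => i iI.
  rewrite ffunE (bigD1 i) ?inE ?eqxx//= linearD linearZ/= scalerDr scalerA.
  rewrite wedge_sign_rem// ltnn mul1r wedge_sign_sqr scale1r finset.setD1K//.
  congr (_ + _); rewrite linear_sum scaler_sumr/=; apply: eq_big => k.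
    by rewrite !inE; case: eqVneq => [->|_]; rewrite ?iI// andbT.
  by move=> _; rewrite linearZ/= scalerA wedge_sign_rem// mulrCA.
have -> : \sum_(k in ~: I) wedge_sign I k *: G k (koszul T x (k |: I)) =
    \sum_(k in ~: I) T k (G k (x I)) - \sum_(i in I) \sum_(k in ~: I) c i k.
  rewrite exchange_big -sumrB/=; apply: eq_bigr => k; rewrite inE => kI.
  rewrite koszulE big_setU1//= linearD linearZ/= scalerDr scalerA.
  rewrite wedge_sign_add// ltnn mul1r wedge_sign_sqr scale1r finset.setU1K//.
  rewrite -bopM_apply -TG; congr (_ + _).
  rewrite linear_sum scaler_sumr -sumrN/=; apply: eq_bigr => i iI.
  have ik : i != k by apply: contraNneq kI => <-.
  rewrite linearZ/= scalerA wedge_sign_add// -bopM_apply -TG.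
  rewrite /c (sign_ltn_anti ik) mulNr scaleNr opprK mulrCA [wedge_sign I k * _]mulrC.
  congr (_ *: T i (G k (x _))); apply/finset.setP => j; rewrite !inE.
  by case: (eqVneq j k) => [->|]; rewrite ?(eq_sym k) ?ik.
rewrite addrACA subrr addr0 -[RHS]/((1 : boundedOp H) (x I)) -TG1 bop_sum_apply.
rewrite [RHS](bigID [in I])/=; congr (_ + _); apply: eq_bigl => i.
by rewrite inE.
Qed.

End Koszul.

(** * Limits of operators *)

Section OperatorLimits.
Context {R : realType} {H : hilbertType R}.
Implicit Types (S T : boundedOp H) (x : H).

Lemma opnormD S T : opnorm (S + T) <= opnorm S + opnorm T.
Proof.
apply: opnorm_le => [|x]; first by rewrite addr_ge0 ?opnorm_ge0.
by rewrite bopD_apply mulrDl (le_trans (ler_rnormD _ _))// lerD ?rnorm_le_opnorm.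
Qed.

Lemma opnormM S T : opnorm (S * T) <= opnorm S * opnorm T.
Proof.
apply: opnorm_le => [|x]; first by rewrite mulr_ge0 ?opnorm_ge0.
rewrite bopM_apply -mulrA (le_trans (rnorm_le_opnorm _ _))//.
by rewrite ler_wpM2l ?opnorm_ge0 ?rnorm_le_opnorm.
Qed.

Lemma opnormN T : opnorm (- T) = opnorm T.
Proof.
suff le_opnormN S : opnorm (- S) <= opnorm S.
  by apply/eqP; rewrite eq_le le_opnormN -[X in opnorm X <= _]opprK le_opnormN.
apply: opnorm_le => [|x]; first exact: opnorm_ge0.
by rewrite [rnorm _]rnormN rnorm_le_opnorm.
Qed.

Lemma opnorm_le0 T : opnorm T <= 0 -> T = 0.
Proof.
move=> T0; apply: bopP => x /=; apply/eqP; rewrite -rnorm_eq0 eq_le rnorm_ge0 andbT.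
by rewrite (le_trans (rnorm_le_opnorm T x))// mulr_le0_ge0 ?rnorm_ge0.
Qed.

Lemma le_of_cvg0 (e : R ^nat) (a s b : R) : e @ \oo --> (0 : R) ->
  (forall n, a <= s + b * e n) -> a <= s.
Proof.
move=> e0 ae; have : s + b * e n @[n --> \oo] --> s + b * 0.
  by apply: cvgD; [exact: cvg_cst|apply: cvgM => //; exact: cvg_cst].
rewrite mulr0 addr0 => sb; rewrite -(cvg_lim _ sb)//.
by apply: limr_ge; [exact: cvgP sb|exact: nearW].
Qed.

Lemma cauchy_limit (u : H ^nat) (e : R ^nat) : e @ \oo --> (0 : R) ->
    (forall n k, rnorm (u n - u k) <= e n + e k) ->
  exists y, forall n, rnorm (u n - y) <= e n.
Proof.
move=> e0 ue.
have e_small d : 0 < d -> \forall n \near \oo, e n < d.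
  by move=> d0; apply: (cvgr_lt 0 e0).
have : cvg (u @ \oo).
  apply/cauchy_cvgP/cauchy_exP => d d0.
  have dE : d = (complex.Re d)%:C by rewrite RRe_real// gtr0_real.
  have d0' : 0 < complex.Re d by rewrite -(ltcR 0) -dE.
  have [|N _ eN] := e_small (complex.Re d / 2); first by rewrite divr_gt0.
  exists (u N); exists N => // n /= Nn; rewrite -ball_normE/= dE -rnormE ltcR.
  by rewrite (le_lt_trans (ue _ _))// [ltRHS]splitr ltrD// eN/=.
move=> /cvg_ex[y uy]; exists y => n; apply/ler_addgt0Pr => d d0.
have d2 : 0 < d / 2 by rewrite divr_gt0.
have : \forall k \near \oo, `|y - u k| < (d / 2)%:C.
  by apply: (cvgr_dist_lt _ _ uy); rewrite (ltcR 0).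
move: (e_small _ d2) => /[swap] uky /(filterI uky)/filter_ex[k [{}uky ek]].
have -> : u n - y = (u n - u k) - (y - u k) by rewrite opprB addrA subrK.
apply: le_trans (ler_rnormB _ _) _; move: uky; rewrite -rnormE ltcR => uky.
by have := ue n k; lra.
Qed.

(** The operators converge at each vector because [H] is complete; the rate is
    uniform on the unit ball, which carries linearity and boundedness over to the
    limit. *)
Lemma boundedOp_complete (U : (boundedOp H) ^nat) (e : R ^nat) :
    e @ \oo --> (0 : R) -> (forall n k, opnorm (U n - U k) <= e n + e k) ->
  exists Q, forall n, opnorm (U n - Q) <= e n.
Proof.
move=> e0 Ue.
have e_ge0 n : 0 <= e n by have := Ue n n; have := opnorm_ge0 (U n - U n); lra.
have Ux x : exists y, forall n, rnorm (U n x - y) <= e n * rnorm x.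
  apply: cauchy_limit => [|n k].
    rewrite -[X in _ --> X](mul0r (rnorm x)).
    by apply: cvgM => //; exact: cvg_cst.
  rewrite -bopB_apply -mulrDl (le_trans (rnorm_le_opnorm _ _))//.
  by rewrite ler_wpM2r ?rnorm_ge0.
have [f Uf] := choice Ux.
have f_linear : linear f.
  move=> a x y; apply/eqP; rewrite -subr_eq0 -rnorm_eq0 eq_le rnorm_ge0 andbT.
  pose b := rnorm (a *: x + y) + cabs a * rnorm x + rnorm y.
  apply: (le_of_cvg0 (b := b) e0) => n; rewrite add0r.
  have -> : f (a *: x + y) - (a *: f x + f y) =
      a *: (U n x - f x) + (U n y - f y) - (U n (a *: x + y) - f (a *: x + y)).
    by rewrite (linearP (U n)) scalerBr addrACA -opprD [in RHS]opprB [RHS]addrC addrA subrK.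
  apply: le_trans (ler_rnormB _ _) _; have := ler_rnormD (a *: (U n x - f x)) (U n y - f y).
  rewrite rnormZ; have := Uf x n; have := Uf y n; have := Uf (a *: x + y) n.
  have := ler_wpM2l (rnorm_ge0 (a : R[i]^o)) (Uf x n).
  rewrite /b; nra.
have f_bounded : bounded_op f.
  exists (opnorm (U 0%N) + e 0%N) => x.
  rewrite -[f x](subKr (U 0%N x)) (le_trans (ler_rnormB _ _))// mulrDl lerD//.
  exact: rnorm_le_opnorm.
by exists (BoundedOp f_linear f_bounded) => n; apply: opnorm_le => // x; exact: Uf.
Qed.

End OperatorLimits.

(** * Rational functions of operators *)

Section PolynomialEvaluation.
Context {R : realType} {n : nat}.
Implicit Types (z : 'rV[R[i]^o]_n) (p q : mpoly n R[i]).

Lemma mpoly_atD p q z : mpoly_at (p + q) z = mpoly_at p z + mpoly_at q z.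
Proof. exact: mevalD. Qed.

Lemma mpoly_atB p q z : mpoly_at (p - q) z = mpoly_at p z - mpoly_at q z.
Proof. exact: mevalB. Qed.

Lemma mpoly_atM p q z : mpoly_at (p * q) z = mpoly_at p z * mpoly_at q z.
Proof. exact: mevalM. Qed.

Lemma mpoly_at0 z : mpoly_at (0 : mpoly n R[i]) z = 0.
Proof. exact: meval0. Qed.

Lemma mpoly_atZ a p z : mpoly_at (a *: p) z = a * mpoly_at p z.
Proof. exact: mevalZ. Qed.

Lemma mpoly_atC a z : mpoly_at (mpolyC n a) z = a.
Proof. exact: mevalC. Qed.

Lemma mpoly_at1 z : mpoly_at 1 z = 1.
Proof. exact: meval1. Qed.

Lemma mpoly_atX p k z : mpoly_at (p ^+ k) z = mpoly_at p z ^+ k.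
Proof. exact: rmorphXn. Qed.

Lemma mpoly_atXU i z : mpoly_at (mpolyX R[i] (mnm1 i)) z = z 0 i.
Proof. exact: mevalXU. Qed.

Lemma mpoly_at_monomial (m : multinom n) z :
  mpoly_at (mpolyX R[i] m) z = \prod_(i < n) z 0 i ^+ m i.
Proof. exact: mevalX. Qed.

Lemma mpoly_at_comp k (f : mpoly k R[i]) (g : k.-tuple (mpoly n R[i])) z :
  mpoly_at (comp_mpoly g f) z = mpoly_at f (\row_j mpoly_at (tnth g j) z).
Proof.
by rewrite /mpoly_at comp_mpoly_meval; apply: meval_eq => j; rewrite mxE.
Qed.

End PolynomialEvaluation.

#[local] Opaque mpoly_at mpoly_op.

Section PolynomialSpectralSets.
Context {R : realType} {n : nat}.
Implicit Types (X : set 'rV[R[i]^o]_n) (z : 'rV[R[i]^o]_n).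
Implicit Types p q r : mpoly n R[i].

Lemma supnorm_le X (f : 'rV[R[i]^o]_n -> R[i]) (M : R) : X !=set0 ->
  (forall z, X z -> cabs (f z) <= M) -> supnorm X f <= M.
Proof.
move=> [z0 Xz0] fM; apply: ge_sup; first by exists (cabs (f z0)), z0.
by move=> _ [z Xz <-]; exact: fM.
Qed.

Lemma le_supnorm X (f : 'rV[R[i]^o]_n -> R[i]) (M : R) z :
  (forall z, X z -> cabs (f z) <= M) -> X z -> cabs (f z) <= supnorm X f.
Proof.
move=> fM Xz; apply: ub_le_sup; last by exists z.
by exists M => _ [w Xw <-]; exact: fM.
Qed.

(** Invertibility of [q] in the uniform closure of the polynomials on [X].  By
    [poly_invertible_approx] the constant 1/2 may be replaced by any smaller
    positive one. *)
Definition poly_invertible X q :=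
  exists r, forall z, X z -> cabs (1 - mpoly_at r z * mpoly_at q z) <= 2^-1.

(** Modulo [q], the power [(1 - r q)^k] is 1, while it is small on [X]. *)
Lemma poly_invertible_approx X q : poly_invertible X q ->
  forall k, exists r, forall z, X z ->
    cabs (1 - mpoly_at r z * mpoly_at q z) <= 2^-1 ^+ k.
Proof.
move=> [r rq] k; pose x := 1 - r * q.
exists (r * \sum_(i < k) x ^+ i) => z Xz.
have -> : 1 - mpoly_at (r * \sum_(i < k) x ^+ i) z * mpoly_at q z =
    (1 - mpoly_at r z * mpoly_at q z) ^+ k.
  rewrite -mpoly_atM -(mpoly_at1 z) -mpoly_atM -!mpoly_atB -mpoly_atX.
  congr mpoly_at; rewrite -/x mulrAC -[in RHS](subrK 1 (x ^+ k)) subrX1.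
  by rewrite /x addrAC subrr sub0r mulNr addrC.
by rewrite cabsX lerXn2r ?nnegrE ?rnorm_ge0 ?invr_ge0 ?rq.
Qed.

(** If [|1 - s q| <= 1/4], then [|s| <= 5/(4 m)], so replacing [q] by [r] changes
    [s q] by at most [5/(4 m) * m/5 = 1/4]. *)
Lemma poly_invertible_perturb X q r (m : R) : 0 < m ->
    (forall z, X z -> m <= cabs (mpoly_at q z)) ->
    (forall z, X z -> cabs (mpoly_at q z - mpoly_at r z) <= m / 5) ->
  poly_invertible X q -> poly_invertible X r.
Proof.
move=> m0 qm qr /poly_invertible_approx-/(_ 2)[s sq]; exists s => z Xz.
have := sq z Xz; have := qm z Xz; have := qr z Xz.
move: (mpoly_at q z) (mpoly_at r z) (mpoly_at s z) => x y c xy mx cx.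
have -> : 1 - c * y = (1 - c * x) + c * (x - y) by ring.
have cm : cabs c * m <= 5 / 4.
  rewrite (le_trans (ler_wpM2l (rnorm_ge0 _) mx))// -cabsM.
  rewrite -[c * x](subKr 1) (le_trans (ler_rnormB _ _))// cabs1.
  by move: cx; rewrite expr2; lra.
rewrite (le_trans (ler_rnormD _ _))// cabsM.
have := ler_wpM2l (rnorm_ge0 (c : R[i]^o)) xy.
by move: cx; rewrite expr2; lra.
Qed.

Lemma poly_invertible_path X (q : nat -> mpoly n R[i]) N (m : R) : 0 < m ->
    (forall k z, (k <= N)%N -> X z -> m <= cabs (mpoly_at (q k) z)) ->
    (forall k z, (k < N)%N -> X z ->
      cabs (mpoly_at (q k) z - mpoly_at (q k.+1) z) <= m / 5) ->
  poly_invertible X (q 0%N) -> poly_invertible X (q N).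
Proof.
move=> m0 qm dq q0.
suff path k : (k <= N)%N -> poly_invertible X (q k) by exact: path.
elim: k => [//|k IH kN].
apply: (@poly_invertible_perturb X (q k) (q k.+1) m m0 _ _ (IH (ltnW kN))).
  by move=> z; apply: qm; exact: ltnW.
by move=> z; exact: dq.
Qed.

Context {H : hilbertType R}.
Variables (X : set 'rV[R[i]^o]_n) (T : 'I_n -> boundedOp H).
Hypothesis X0 : X !=set0.
Hypothesis T_comm : commuting T.
Hypothesis poly_bounded :
  forall p, exists M : R, forall z, X z -> cabs (mpoly_at p z) <= M.
Hypothesis von_neumann :
  forall p, opnorm (mpoly_op p T) <= supnorm X (mpoly_at p).

Lemma opnorm_mpoly_op_le p (M : R) :
  (forall z, X z -> cabs (mpoly_at p z) <= M) -> opnorm (mpoly_op p T) <= M.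
Proof. by move=> pM; rewrite (le_trans (von_neumann p))// supnorm_le. Qed.

(** The inverse of [q(T)] is the limit of [r_k(T)] for polynomials [r_k] that
    converge to [1 / q] on [X]: the von Neumann inequality turns uniform estimates
    on [X] into estimates in operator norm. *)
Lemma rational_von_neumann q (m : R) : 0 < m ->
    (forall z, X z -> m <= cabs (mpoly_at q z)) -> poly_invertible X q ->
  exists Q : boundedOp H, [/\ mpoly_op q T * Q = 1, Q * mpoly_op q T = 1 &
    forall p, opnorm (mpoly_op p T * Q)
      <= supnorm X (fun z => mpoly_at p z / mpoly_at q z)].
Proof.
move=> m0 qm /poly_invertible_approx/choice[r rq].
(* A bound for [|r_k - 1 / q|] on [X]. *)
pose e k : R := m^-1 * 2^-1 ^+ k.
have e0 : e @ \oo --> (0 : R).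
  by apply: cvg_geometric; rewrite ger0_norm ?invr_ge0// invf_lt1// ltr1n.
have e_ge0 k : 0 <= e k by rewrite mulr_ge0 ?exprn_ge0 ?invr_ge0 ?(ltW m0).
have q_neq0 z : X z -> mpoly_at q z != 0.
  by move=> Xz; rewrite -rnorm_gt0 (lt_le_trans m0)// qm.
have rV k z : X z -> cabs (mpoly_at (r k) z - (mpoly_at q z)^-1) <= e k.
  move=> Xz; have -> : mpoly_at (r k) z - (mpoly_at q z)^-1 =
      - ((mpoly_at q z)^-1 * (1 - mpoly_at (r k) z * mpoly_at q z)).
    by rewrite mulrBr mulr1 mulrCA mulVf ?q_neq0// mulr1 opprB.
  rewrite rnormN cabsM ler_pM ?rnorm_ge0 ?rq// cabsV lef_pV2 ?qm// posrE.
  by rewrite (lt_le_trans m0)// qm.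
have [|Q rQ] := boundedOp_complete (U := fun k => mpoly_op (r k) T) e0.
  move=> j k; rewrite -mpoly_opB; apply: opnorm_mpoly_op_le => z Xz.
  rewrite mpoly_atB -(subrKA (mpoly_at q z)^-1) (le_trans (ler_rnormD _ _))//.
  by rewrite lerD ?rV// rnormB rV.
exists Q; split.
- apply/eqP; rewrite eq_sym -subr_eq0; apply/eqP/opnorm_le0.
  apply: (le_of_cvg0 (b := m + opnorm (mpoly_op q T)) e0) => k.
  have -> : 1 - mpoly_op q T * Q =
      mpoly_op (1 - r k * q) T + mpoly_op q T * (mpoly_op (r k) T - Q).
    by rewrite mpoly_opB mpoly_op1 mulrC mpoly_opM// mulrBr addrA subrK.
  rewrite add0r [leRHS]mulrDl (le_trans (opnormD _ _))// lerD//.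
    apply: opnorm_mpoly_op_le => z Xz; rewrite mpoly_atB mpoly_at1 mpoly_atM.
    by rewrite /e mulVKf ?gt_eqF// rq.
  by rewrite (le_trans (opnormM _ _))// ler_wpM2l ?opnorm_ge0.
- apply/eqP; rewrite eq_sym -subr_eq0; apply/eqP/opnorm_le0.
  apply: (le_of_cvg0 (b := m + opnorm (mpoly_op q T)) e0) => k.
  have -> : 1 - Q * mpoly_op q T =
      mpoly_op (1 - r k * q) T + (mpoly_op (r k) T - Q) * mpoly_op q T.
    by rewrite mpoly_opB mpoly_op1 mpoly_opM// mulrBl addrA subrK.
  rewrite add0r [leRHS]mulrDl (le_trans (opnormD _ _))// lerD//.
    apply: opnorm_mpoly_op_le => z Xz; rewrite mpoly_atB mpoly_at1 mpoly_atM.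
    by rewrite /e mulVKf ?gt_eqF// rq.
  by rewrite (le_trans (opnormM _ _))// mulrC ler_wpM2l ?opnorm_ge0.
move=> p; have [M pM] := poly_bounded p.
have M0 : 0 <= M by have [z Xz] := X0; exact: le_trans (rnorm_ge0 _) (pM _ Xz).
apply: (le_of_cvg0 (b := M + opnorm (mpoly_op p T)) e0) => k.
have -> : mpoly_op p T * Q = mpoly_op (p * r k) T - mpoly_op p T * (mpoly_op (r k) T - Q).
  by rewrite mpoly_opM// mulrBr opprB addrC subrK.
rewrite [X in _ <= _ + X]mulrDl addrA (le_trans (opnormD _ _))// lerD//; last first.
  rewrite opnormN (le_trans (opnormM _ _))//.
  by rewrite ler_wpM2l ?opnorm_ge0.
apply: opnorm_mpoly_op_le => z Xz; rewrite mpoly_atM.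
rewrite -[mpoly_at (r k) z](subrK (mpoly_at q z)^-1) mulrDr [leRHS]addrC.
apply: le_trans (ler_rnormD _ _) _; apply: lerD.
  by rewrite cabsM ler_pM ?rnorm_ge0 ?pM ?rV.
apply: (le_supnorm (f := fun z => mpoly_at p z / mpoly_at q z) (M := M / m)) => // w Xw.
rewrite cabsM ler_pM ?rnorm_ge0 ?pM// cabsV lef_pV2 ?qm// posrE.
by rewrite (lt_le_trans m0)// qm.
Qed.

End PolynomialSpectralSets.

(** * Polynomials on compact sets *)

Section Topology.
Context {R : realType}.

Lemma cabs_continuous : continuous (fun a : R[i]^o => cabs a).
Proof.
move=> a; apply/(@cvgrPdist_lt _ _ _ (nbhs a) (nbhs_filter a)) => e e0.
have : nbhs a (ball a e%:C) by apply: nbhsx_ballx; rewrite (ltcR 0).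
apply: filterS => b; rewrite -ball_normE/= -rnormE ltcR; apply: le_lt_trans.
rewrite ler_norml; have := ler_rnormD (a - b) b; have := ler_rnormB a (a - b).
by rewrite subKr subrK; lra.
Qed.

Lemma real_complex_continuous : continuous (fun x : R => x%:C : R[i]^o).
Proof.
move=> x; apply/cvgrPdist_lt => e e0.
have eE : e = (complex.Re e)%:C by rewrite RRe_real// gtr0_real.
have e0' : 0 < complex.Re e by rewrite -(ltcR 0) -eE.
have : nbhs x (ball x (complex.Re e)) by exact: nbhsx_ballx.
apply: filterS => y; rewrite -ball_normE/= => xy; rewrite eE -rmorphB/= -rnormE ltcR.
by rewrite cabs_real.
Qed.

(** The disc is the image of a closed part of the square [-1, 1] x [-1, 1] of real
    and imaginary parts. *)
Lemma unit_disc_compact : compact [set a : R[i]^o | cabs a <= 1].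
Proof.
pose phi (p : R * R) : R[i]^o := p.1%:C + 'i * p.2%:C.
have phi_continuous : continuous phi.
  move=> p; apply: cvgD.
    apply: (@continuous_comp _ _ _ fst (fun x : R => x%:C : R[i]^o)).
      exact: cvg_fst.
    exact: real_complex_continuous.
  apply: cvgM; first exact: cvg_cst.
  apply: (@continuous_comp _ _ _ snd (fun x : R => x%:C : R[i]^o)).
    exact: cvg_snd.
  exact: real_complex_continuous.
pose K := [set p : R * R | cabs (phi p) <= 1] `&` (`[-1, 1] `*` `[-1, 1]).
have -> : [set a : R[i]^o | cabs a <= 1] = phi @` K.
  apply/seteqP; split => [a /= a1|_ [p [p1 _] <-]//].
  exists (complex.Re a, complex.Im a); last by rewrite /phi/= [RHS]complexE.
  have aE : phi (complex.Re a, complex.Im a) = a by rewrite /phi/= [RHS]complexE.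
  split; rewrite /= ?aE// !in_itv/= -!ler_norml.
  split; rewrite (le_trans _ a1)// -lecR rnormE; first exact: normc_ge_Re.
  rewrite -[leRHS]mul1r -(normCi R[i]) -normrM (le_trans _ (normc_ge_Re _))//.
  by case: (a) => x y; rewrite -complexiE lecR /= mul0r mul1r sub0r normrN.
apply: (@continuous_compact _ _ phi K); first exact: continuous_subspaceT.
have cS := compact_setX (@segment_compact R (-1) 1) (@segment_compact R (-1) 1).
apply: (subclosed_compact _ cS); last by move=> p [].
apply: closedI; last by apply: compact_closed => //; exact: norm_hausdorff.
apply: (@closed_comp _ _ (fun p => cabs (phi p)) [set x | x <= 1]).
  move=> p _; apply: (@continuous_comp _ _ _ phi (fun a : R[i]^o => cabs a)).
    exact: phi_continuous.
  exact: cabs_continuous.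
exact: closed_le.
Qed.

(** Continuity into the row vectors is tested on coordinates, because the index
    set is finite. *)
Lemma row_continuous (S : topologicalType) n (f : S -> 'rV[R[i]^o]_n) :
  (forall j, continuous (fun x => f x 0 j)) -> continuous f.
Proof.
move=> fc x; apply/cvg_mx_entourageP => A entA.
have : \forall y \near x, forall j, A (f x 0 j, f y 0 j).
  apply: filter_forall => j.
  exact: (@cvg_app_entourageP _ _ _ (nbhs x) (nbhs_filter x) _).1 (fc j x) A entA.
by apply: filterS => y fA i j; rewrite inE ord1.
Qed.

Lemma continuous_add (S : topologicalType) (f g : S -> R[i]^o) :
  continuous f -> continuous g -> continuous (fun x => f x + g x).
Proof. by move=> fc gc x; apply: cvgD; [exact: fc|exact: gc]. Qed.

Lemma continuous_mul (S : topologicalType) (f g : S -> R[i]^o) :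
  continuous f -> continuous g -> continuous (fun x => f x * g x : R[i]^o).
Proof. by move=> fc gc x; apply: cvgM; [exact: fc|exact: gc]. Qed.

Lemma mpoly_at_continuous n (p : mpoly n R[i]) :
  continuous (mpoly_at p : 'rV[R[i]^o]_n -> R[i]^o).
Proof.
have cst_cont (a : R[i]^o) : continuous ((fun=> a) : 'rV[R[i]^o]_n -> R[i]^o).
  exact: cst_continuous.
elim/mpolyind: p => [|c m p _ _ IH].
  have -> : mpoly_at (0 : mpoly n R[i]) = fun=> 0 by apply/funext => z; exact: mpoly_at0.
  exact: cst_cont.
have -> : mpoly_at (c *: mpolyX R[i] m + p) =
    fun z => c * \prod_(i < n) z 0 i ^+ m i + mpoly_at p z.
  by apply/funext => z; rewrite mpoly_atD mpoly_atZ mpoly_at_monomial.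
apply: continuous_add IH; apply: continuous_mul; first exact: cst_cont.
elim: (index_enum _) => [|i s IHs]; first by under eq_fun do rewrite big_nil; exact: cst_cont.
under eq_fun do rewrite big_cons.
apply: continuous_mul IHs; elim: (m i) => [|k IHk].
  by under eq_fun do rewrite expr0; exact: cst_cont.
under eq_fun do rewrite exprS.
by apply: continuous_mul IHk; exact: coord_continuous.
Qed.

Lemma continuous_cabs_mpoly_at n (p : mpoly n R[i]) :
  continuous (fun z : 'rV[R[i]^o]_n => cabs (mpoly_at p z)).
Proof.
move=> z; apply: (@continuous_comp _ R[i]^o _ _ (fun a : R[i]^o => cabs a)).
  exact: (@mpoly_at_continuous n p z).
exact: cabs_continuous.
Qed.

Variables (n : nat) (X : set 'rV[R[i]^o]_n).
Hypotheses (X0 : X !=set0) (X_compact : compact X).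

Lemma mpoly_at_bounded (p : mpoly n R[i]) :
  exists M : R, forall z, X z -> cabs (mpoly_at p z) <= M.
Proof.
have [z _ pz] := compact_EVT_max X0 X_compact
  (continuous_subspaceT (@continuous_cabs_mpoly_at n p)).
by exists (cabs (mpoly_at p z)) => w Xw; apply: pz; rewrite inE.
Qed.

Lemma mpoly_at_bounded_below (q : mpoly n R[i]) :
    (forall z, X z -> mpoly_at q z != 0) ->
  exists2 m : R, 0 < m & forall z, X z -> m <= cabs (mpoly_at q z).
Proof.
move=> q0; have [z Xz qz] := compact_EVT_min X0 X_compact
  (continuous_subspaceT (@continuous_cabs_mpoly_at n q)).
exists (cabs (mpoly_at q z)); first by rewrite rnorm_gt0 q0// -inE.
by move=> w Xw; apply: qz; rewrite inE.
Qed.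

End Topology.

(** * Weighted dilations *)

Section Dilations.
Context {R : realType} {n : nat}.
Implicit Types (w : R[i]) (z : 'rV[R[i]^o]_n) (f : mpoly n R[i]).

(** The coordinate of index [k] has weight [k + 1], the degree of the elementary
    symmetric polynomial that it stands for. *)
Definition dilate_point w z : 'rV[R[i]^o]_n := \row_k (w ^+ k.+1 * z 0 k).

Lemma mpoly_dilate w f : exists2 g : mpoly n R[i],
    forall z, mpoly_at g z = mpoly_at f (dilate_point w z) &
    forall (H : hilbertType R) (T : 'I_n -> boundedOp H), commuting T ->
      mpoly_op g T = mpoly_op f (fun k => w ^+ k.+1 *: T k).
Proof.
exists (comp_mpoly [tuple w ^+ k.+1 *: mpolyX R[i] (mnm1 k) | k < n] f).
  move=> z; rewrite mpoly_at_comp; congr (mpoly_at f _); apply/rowP => k.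
  by rewrite !mxE tnth_mktuple mpoly_atZ mpoly_atXU.
move=> H T T_comm; rewrite mpoly_op_comp//; congr mpoly_op; apply/funext => k.
by rewrite tnth_mktuple [LHS]mpoly_opZ mpoly_opXU.
Qed.

Lemma mpoly_at_monomial_dilate w (m : multinom n) z :
  mpoly_at (mpolyX R[i] m) (dilate_point w z) =
    w ^+ (\sum_(k < n) k.+1 * m k) * mpoly_at (mpolyX R[i] m) z.
Proof.
rewrite !mpoly_at_monomial -prodrXr -big_split/=; apply: eq_bigr => k _.
by rewrite mxE exprMn exprM.
Qed.

Lemma ler_dist_exp (a b : R) k : 0 <= a <= 1 -> 0 <= b <= 1 ->
  `|a ^+ k - b ^+ k| <= k%:R * `|a - b|.
Proof.
move=> /andP[a0 a1] /andP[b0 b1]; elim: k => [|k IH].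
  by rewrite !expr0 subrr normr0 mul0r.
have -> : a ^+ k.+1 - b ^+ k.+1 = a * (a ^+ k - b ^+ k) + b ^+ k * (a - b).
  by rewrite !exprS; ring.
rewrite -natr1 mulrDl mul1r (le_trans (ler_normD _ _))// lerD// normrM ger0_norm ?exprn_ge0//.
  by rewrite (le_trans _ IH)// ler_piMl.
by rewrite ler_piMl// exprn_ile1.
Qed.

(** A monomial of weight [d] is multiplied by [t^d] under the dilation by [t], and
    [t |-> t^d] has Lipschitz constant [d] on the unit interval. *)
Lemma mpoly_at_dilate_lipschitz (X : set 'rV[R[i]^o]_n) f :
    (forall p : mpoly n R[i], exists M : R, forall z, X z -> cabs (mpoly_at p z) <= M) ->
  exists L : R, forall a b : R, 0 <= a <= 1 -> 0 <= b <= 1 -> forall z, X z ->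
    cabs (mpoly_at f (dilate_point a%:C z) - mpoly_at f (dilate_point b%:C z))
      <= L * `|a - b|.
Proof.
move=> Xb; elim/mpolyind: f => [|c m f _ _ [L fL]].
  by exists 0 => a b _ _ z _; rewrite !mpoly_at0 subrr rnorm0 mul0r.
have [M mM] := Xb (mpolyX R[i] m).
set d := (\sum_(k < n) k.+1 * m k)%N.
exists (cabs c * (d%:R * M) + L) => a b ha hb z Xz.
rewrite !mpoly_atD opprD addrACA [leRHS]mulrDl.
apply: le_trans (ler_rnormD _ _) _; apply: lerD; last exact: fL.
rewrite ![mpoly_at (c *: _) _]mpoly_atZ -mulrBr cabsM -mulrA.
rewrite ler_wpM2l ?rnorm_ge0// !mpoly_at_monomial_dilate -mulrBl.
rewrite cabsM -!rmorphXn -rmorphB cabs_real mulrAC ler_pM ?rnorm_ge0 ?mM//.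
exact: ler_dist_exp.
Qed.

End Dilations.

(** * The symmetrized tridisc *)

Section SymmetrizedTridisc.
Context {R : realType}.
Implicit Types (z : 'rV[R[i]^o]_3).

Lemma forall_ord3 (P : 'I_3 -> Prop) :
  P 0 -> P 1 -> P (inord 2) -> forall k, P k.
Proof.
move=> P0 P1 P2 [[|[|[|//]]] k3].
- by rewrite (_ : Ordinal k3 = 0)//; exact: val_inj.
- by rewrite (_ : Ordinal k3 = 1)//; exact: val_inj.
- by rewrite (_ : Ordinal k3 = inord 2)//; apply: val_inj; rewrite /= inordK.
Qed.

Lemma sum_ord3 (V : nmodType) (F : 'I_3 -> V) :
  \sum_k F k = F 0 + F 1 + F (inord 2).
Proof.
rewrite !big_ord_recr big_ord0/= add0r; congr (F _ + F _ + F _); apply: val_inj => //=.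
by rewrite inordK.
Qed.

Lemma triple0 (A : Type) (a b c : A) : triple a b c 0 = a.
Proof. by []. Qed.

Lemma triple1 (A : Type) (a b c : A) : triple a b c 1 = b.
Proof. by []. Qed.

Lemma triple2 (A : Type) (a b c : A) : triple a b c (inord 2) = c.
Proof. by rewrite /triple (tnth_nth a)/= inordK. Qed.

Definition tripleE := (triple0, triple1, triple2).

Definition symmetrization (v : 'rV[R[i]^o]_3) : 'rV[R[i]^o]_3 :=
  let: z1 := v 0 0 in let: z2 := v 0 1 in let: z3 := v 0 (inord 2) in
  \row_k triple (z1 + z2 + z3) (z1 * z2 + z2 * z3 + z3 * z1) (z1 * z2 * z3) k.

Lemma Gamma3E :
  Gamma3 R = symmetrization @` [set v : 'rV[R[i]^o]_3 | forall k, cabs (v 0 k) <= 1].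
Proof.
apply/seteqP; split=> [_ [z1 [z2 [z3 [h1 h2 h3 ->]]]]|_ [v /= v1 <-]].
  exists (\row_k triple z1 z2 z3 k); last by rewrite /symmetrization !mxE !tripleE.
  by apply: forall_ord3; rewrite mxE tripleE -cabs_le1.
by exists (v 0 0), (v 0 1), (v 0 (inord 2)); split; rewrite ?cabs_le1.
Qed.

Lemma Gamma3_compact : compact (Gamma3 R).
Proof.
rewrite Gamma3E; apply: continuous_compact; last first.
  exact: (@rV_compact _ _ (fun=> [set a : R[i]^o | cabs a <= 1]) (fun=> unit_disc_compact)).
apply: continuous_subspaceT; apply: row_continuous.
have c k : continuous (fun v : 'rV[R[i]^o]_3 => v 0 k : R[i]^o).
  exact: coord_continuous.
apply: forall_ord3; under eq_fun do rewrite mxE tripleE.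
- by apply: continuous_add; [apply: continuous_add|].
- by apply: continuous_add; [apply: continuous_add|]; apply: continuous_mul.
- by apply: continuous_mul; [apply: continuous_mul|].
Qed.

Lemma Gamma3_dilate w z : cabs w <= 1 -> Gamma3 R z -> Gamma3 R (dilate_point w z).
Proof.
move=> w1 [z1 [z2 [z3]]]; rewrite !cabs_le1 => -[h1 h2 h3 ->].
exists (w * z1), (w * z2), (w * z3); split;
  rewrite ?cabs_le1 ?cabsM ?mulr_ile1 ?rnorm_ge0//.
apply/rowP; apply: forall_ord3; rewrite !mxE !tripleE.
- by rewrite expr1; ring.
- by ring.
- by rewrite inordK//; ring.
Qed.

Lemma Gamma3_0 : Gamma3 R 0.
Proof.
exists 0, 0, 0; split; rewrite ?normr0//.
by apply/rowP; apply: forall_ord3; rewrite !mxE !tripleE; ring.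
Qed.

(** Extract one root [z1], then a root [z2] of the quadratic cofactor, whose
    coefficients are [t = s1 - z1] and [s2 - z1 t]. *)
Lemma cubic_factorization (s1 s2 p : R[i]) : exists z1 z2 z3 : R[i],
  [/\ s1 = z1 + z2 + z3, s2 = z1 * z2 + z2 * z3 + z3 * z1 & p = z1 * z2 * z3].
Proof.
have [z1] := solve_monicpoly (fun k => nth 0 [:: p; - s2; s1] k) (isT : (0 < 3)%N).
rewrite !big_ord_recr big_ord0/= add0r expr0 mulr1 expr1 => z1E.
pose t := s1 - z1.
have [z2] := solve_monicpoly (fun k => nth 0 [:: - (s2 - z1 * t); t] k) (isT : (0 < 2)%N).
rewrite !big_ord_recr big_ord0/= add0r expr0 mulr1 expr1 => z2E.
exists z1, z2, (t - z2); rewrite /t; split.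
- by ring.
- transitivity (z2 * t - z2 ^+ 2 + z1 * t); last by rewrite /t; ring.
  by rewrite z2E; ring.
- transitivity (z1 * (z2 * t - z2 ^+ 2)); last by rewrite /t; ring.
  transitivity (z1 ^+ 3 - s1 * z1 ^+ 2 + s2 * z1); first by rewrite z1E; ring.
  by rewrite z2E /t; ring.
Qed.

(** The three roots of this cubic have the coordinates of [z] as elementary
    symmetric functions, so they cannot all lie in the closed unit disc. *)
Lemma notin_Gamma3_root z : ~ Gamma3 R z -> exists2 a : R[i], 1 < cabs a &
  a ^+ 3 - a ^+ 2 * z 0 0 + a * z 0 1 - z 0 (inord 2) = 0.
Proof.
move=> zG; have [z1 [z2 [z3 [s1E s2E pE]]]] := cubic_factorization (z 0 0) (z 0 1) (z 0 (inord 2)).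
have [h1|h1] := leP (cabs z1) 1; last by exists z1 => //; rewrite s1E s2E pE; ring.
have [h2|h2] := leP (cabs z2) 1; last by exists z2 => //; rewrite s1E s2E pE; ring.
have [h3|h3] := leP (cabs z3) 1; last by exists z3 => //; rewrite s1E s2E pE; ring.
exfalso; apply: zG; exists z1, z2, z3; split; rewrite ?cabs_le1//.
by apply/rowP; apply: forall_ord3; rewrite !mxE !tripleE.
Qed.

Lemma Gamma3_root z a : Gamma3 R z ->
  a ^+ 3 - a ^+ 2 * z 0 0 + a * z 0 1 - z 0 (inord 2) = 0 -> cabs a <= 1.
Proof.
move=> [z1 [z2 [z3]]]; rewrite !cabs_le1 => -[h1 h2 h3 ->]; rewrite !mxE !tripleE.
have -> : a ^+ 3 - a ^+ 2 * (z1 + z2 + z3) + a * (z1 * z2 + z2 * z3 + z3 * z1) -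
    z1 * z2 * z3 = (a - z1) * (a - z2) * (a - z3) by ring.
by move/eqP; rewrite !mulf_eq0 !subr_eq0 => /orP[/orP[]|] /eqP ->.
Qed.

(** The dilations of [q] by [k / (N + 1)] lead from the constant [q(0)] to [q] while
    staying above [min |q|]; [N] is chosen by the Lipschitz constant so that each
    step is small enough for [poly_invertible_path]. *)
Lemma Gamma3_poly_invertible (q : mpoly 3 R[i]) :
  (forall z, Gamma3 R z -> mpoly_at q z != 0) -> poly_invertible (Gamma3 R) q.
Proof.
move=> q0; have G0 : Gamma3 R !=set0 by exists 0; exact: Gamma3_0.
have [m m0 qm] := mpoly_at_bounded_below G0 Gamma3_compact q0.
have [L qL] := mpoly_at_dilate_lipschitz q (mpoly_at_bounded G0 Gamma3_compact).
have [N NL] : exists N : nat, 5 * L / m <= N.+1%:R.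
  by exists (Num.truncn (5 * L / m)); rewrite ltW// truncnS_gt.
pose t k : R := k%:R / N.+1%:R.
have t01 k : (k <= N.+1)%N -> 0 <= t k <= 1.
  by move=> kN; rewrite divr_ge0//= ler_pdivrMr ?ltr0n// mul1r ler_nat.
have /choice[g gE] k : exists g : mpoly 3 R[i],
    forall z, mpoly_at g z = mpoly_at q (dilate_point (t k)%:C z).
  by have [g gE _] := mpoly_dilate (t k)%:C q; exists g.
have path : poly_invertible (Gamma3 R) (g N.+1).
  apply: (poly_invertible_path m0).
  - move=> k z kN Gz; rewrite gE; apply/qm/Gamma3_dilate => //.
    by have /andP[t0 t1] := t01 k kN; rewrite cabs_real ger0_norm.
  - move=> k z kN Gz; rewrite !gE.
    apply: le_trans (qL _ _ (t01 _ (ltnW kN)) (t01 _ kN) z Gz) _.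
    rewrite distrC /t -mulrBl -natrB// subSnn mul1r ger0_norm ?invr_ge0//.
    by rewrite ler_pdivrMr ?ltr0n//; move: NL; rewrite ler_pdivrMr//; lra.
  exists (mpolyC 3 (mpoly_at q 0)^-1) => z Gz; rewrite mpoly_atC gE.
  have -> : dilate_point (t 0)%:C z = 0.
    by apply/rowP => k; rewrite !mxE /t mul0r expr0n mul0r.
  by rewrite mulVf ?q0 ?subrr ?rnorm0//; exact: Gamma3_0.
have [r hr] := path; exists r => z Gz; have := hr z Gz; rewrite gE.
suff -> : dilate_point (t N.+1)%:C z = z by [].
by apply/rowP => k; rewrite mxE /t divff ?pnatr_eq0// expr1n mul1r.
Qed.

End SymmetrizedTridisc.

(** * The Taylor spectrum *)

Section TaylorSpectrum.
Context {R : realType} {H : hilbertType R} {n : nat}.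

Lemma comm_inverse (S A B : boundedOp H) :
  GRing.comm S A -> A * B = 1 -> B * A = 1 -> GRing.comm S B.
Proof.
move=> SA AB BA; rewrite /GRing.comm -[S * B]mul1r -BA -mulrA.
by rewrite [A * (S * B)]mulrA -SA -[S * A * B]mulrA AB mulr1.
Qed.

Definition affine_mpoly (a : R[i]) (c : 'I_n -> R[i]) : mpoly n R[i] :=
  mpolyC n a + \sum_k c k *: mpolyX R[i] (mnm1 k).

Lemma mpoly_at_affine a c (z : 'rV[R[i]^o]_n) :
  mpoly_at (affine_mpoly a c) z = a + \sum_k c k * z 0 k.
Proof.
rewrite mpoly_atD mpoly_atC; congr (_ + _).
rewrite (big_morph (fun p => mpoly_at p z) (fun p q => mpoly_atD p q z) (mpoly_at0 z)).
by apply: eq_bigr => k _; rewrite mpoly_atZ mpoly_atXU.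
Qed.

Lemma mpoly_op_affine a c (T : 'I_n -> boundedOp H) :
  mpoly_op (affine_mpoly a c) T = a *: (1 : boundedOp H) + (\sum_k c k *: T k : boundedOp H).
Proof.
rewrite mpoly_opD mpoly_op_sum; congr (_ + _).
  by rewrite -[mpolyC n a]mulr1 mul_mpolyC mpoly_opZ mpoly_op1.
by apply: eq_bigr => k _; rewrite mpoly_opZ mpoly_opXU.
Qed.

(** An affine polynomial that vanishes at [z] is a combination of the [T_k - z_k]
    after substitution of [T]; if it is invertible there, then the [c_k Q] solve
    the equation of [koszul_exact_of_unimodular]. *)
Lemma notin_taylor_spectrum (T : 'I_n -> boundedOp H) (z : 'rV[R[i]^o]_n) a c
    (Q : boundedOp H) :
    commuting T -> mpoly_at (affine_mpoly a c) z = 0 ->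
    mpoly_op (affine_mpoly a c) T * Q = 1 -> Q * mpoly_op (affine_mpoly a c) T = 1 ->
  ~ taylor_spectrum T z.
Proof.
move=> T_comm; rewrite mpoly_at_affine => z0 TQ QT; apply.
have TQc k : GRing.comm (T k) Q.
  by apply: comm_inverse TQ QT; rewrite -(mpoly_opXU T k); exact: mpoly_op_comm.
apply: (@koszul_exact_of_unimodular _ _ _ _ _ (fun k => c k *: Q)).
- move=> i k; apply: commrB.
    by apply/commr_sym/commrB; [exact: T_comm|apply/bop_commZ/commr1].
  by apply: bop_commZ; exact: commr1.
- move=> i k; apply/commr_sym/commrB; first exact/commr_sym/bop_commZ.
  by apply: bop_commZ; exact: commr1.
have TE : mpoly_op (affine_mpoly a c) T =
    \sum_k c k *: (T k - (z 0 k : R[i]) *: (1 : boundedOp H)).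
  rewrite mpoly_op_affine; under [RHS]eq_bigr do rewrite scalerBr scalerA.
  rewrite sumrB -scaler_suml addrC; congr (_ + _).
  by rewrite -scaleNr; congr (_ *: _); apply/eqP; rewrite -addr_eq0 z0.
rewrite -[RHS]TQ TE mulr_suml; apply: eq_bigr => k _.
by rewrite bopZAr bopZAl.
Qed.

End TaylorSpectrum.

(** * From polynomials to spectral sets *)

Section Gamma3Contractions.
Context {R : realType} {H : hilbertType R}.

Lemma commuting_triple (A B C : boundedOp H) :
  GRing.comm A B -> GRing.comm A C -> GRing.comm B C -> commuting (triple A B C).
Proof.
move=> AB AC BC; apply: forall_ord3; apply: forall_ord3; rewrite !tripleE //; exact/commr_sym.
Qed.

(** Each polynomial without zeros in [Gamma3 R] gives an invertible operator with
    the right norm bounds; the spectrum inclusion is the case of the polynomials of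
    degree 1 that separate a point from [Gamma3 R]. *)
Lemma von_neumann_Gamma3_spectral (T : 'I_3 -> boundedOp H) : commuting T ->
    (forall f, opnorm (mpoly_op f T) <= supnorm (Gamma3 R) (mpoly_at f)) ->
  spectral_set (Gamma3 R) T.
Proof.
move=> T_comm T_vN; have G0 : Gamma3 R !=set0 by exists 0; exact: Gamma3_0.
have bounded := mpoly_at_bounded G0 (@Gamma3_compact R).
have rational (q : mpoly 3 R[i]) : (forall z, Gamma3 R z -> mpoly_at q z != 0) ->
    exists Q : boundedOp H, [/\ mpoly_op q T * Q = 1, Q * mpoly_op q T = 1 &
      forall p, opnorm (mpoly_op p T * Q)
        <= supnorm (Gamma3 R) (fun z => mpoly_at p z / mpoly_at q z)].
  move=> q0; have [m m0 qm] := mpoly_at_bounded_below G0 (@Gamma3_compact R) q0.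
  by apply: rational_von_neumann m0 qm _ => //; exact: Gamma3_poly_invertible.
split=> // [|z Tz|p q q0]; first exact: Gamma3_compact; last first.
  by have [Q [qQ Qq pQ]] := rational q q0; exists Q; split.
apply: contrapT => /notin_Gamma3_root[a a1 az].
(* [a^3 - a^2 s1 + a s2 - p = (a - z1) (a - z2) (a - z3)] *)
pose c := triple (- a ^+ 2) a (-1).
have cE (w : 'rV[R[i]^o]_3) : mpoly_at (affine_mpoly (a ^+ 3) c) w =
    a ^+ 3 - a ^+ 2 * w 0 0 + a * w 0 1 - w 0 (inord 2).
  by rewrite mpoly_at_affine sum_ord3 /c !tripleE; ring.
have [w Gw|Q [cQ Qc _]] := rational (affine_mpoly (a ^+ 3) c).
  apply/eqP; rewrite cE => /(Gamma3_root Gw); by rewrite leNgt a1.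
by apply: notin_taylor_spectrum T_comm _ cQ Qc Tz; rewrite cE.
Qed.

End Gamma3Contractions.

Theorem theorem2p2 (R : realType) (H : hilbertType R) (S1 S2 P : boundedOp H)
    (S1S2 : S1 * S2 = S2 * S1) (S1P : S1 * P = P * S1) (S2P : S2 * P = P * S2) :
  [<-> Gamma3_contraction S1 S2 P;
       forall f : mpoly 3 R[i],
         opnorm (mpoly_op f (triple S1 S2 P))
           <= supnorm (Gamma3 R) (mpoly_at f);
       forall w : R[i], `|w| = 1 ->
         Gamma3_contraction (w *: S1) (w ^+ 2 *: S2) (w ^+ 3 *: P)].
Proof.
have T_comm : commuting (triple S1 S2 P) by exact: commuting_triple.
tfae.
- move=> [_ _ _ rational] f.
  have [z _|Q [Q1 _]] := rational f 1; first by rewrite mpoly_at1 oner_neq0.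
  have {Q1} -> : Q = 1 by move: Q1; rewrite mpoly_op1 mul1r.
  rewrite mulr1; congr (_ <= supnorm _ _); apply/funext => z.
  by rewrite mpoly_at1 divr1.
(* Composing [f] with the dilation by [w] does not increase its supremum. *)
- move=> T_vN w w1; have cw : cabs w = 1.
    by apply: (@complexI R); rewrite rnormE; exact: w1.
  have wT : triple (w *: S1) (w ^+ 2 *: S2) (w ^+ 3 *: P) =
      fun k => w ^+ k.+1 *: triple S1 S2 P k.
    by apply/funext; apply: forall_ord3; rewrite !tripleE ?expr1 ?inordK.
  apply: von_neumann_Gamma3_spectral => [|f].
    by apply: commuting_triple; apply/bop_commZ/commr_sym/bop_commZ/commr_sym.
  have [g gE gT] := mpoly_dilate w f; rewrite wT -gT//.
  apply: le_trans (T_vN g) _; have G0 := @Gamma3_0 R.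
  have [M fM] := mpoly_at_bounded (ex_intro _ 0 G0) (@Gamma3_compact R) f.
  apply: supnorm_le => [|z Gz]; first by exists 0.
  by rewrite gE; apply: le_supnorm fM _; apply: Gamma3_dilate; rewrite ?cw.
- by move=> /(_ 1); rewrite normr1 !expr1n !scale1r; exact.
Qed.
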